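(* There is a constant $k$ such that every (claw, $4K_1$, bridge)-free graph $G$ that contains a $C_7$ (as an induced subgraph) has clique-width at most $k$.
   Context: All graphs are finite, simple and undirected. For a set $L$ of graphs, a graph $G$ is $L$-free if $G$ contains no graph of $L$ as an induced subgraph. $C_7$ is the chordless cycle on seven vertices. The claw is $K_{1,3}$. $4K_1$ is the stable set on four vertices. The bridge is the six-vertex graph obtained from two disjoint copies of $K_4$ by identifying an edge of one with an edge of the other: its vertices are $u,v,a,b,c,d$, the sets $\{u,v,a,b\}$ and $\{u,v,c,d\}$ are cliques, and there are no edges between $\{a,b\}$ and $\{c,d\}$. The clique-width of a graph is the smallest number of labels needed to construct it using the operations: create a new vertex with label $i$; take the disjoint union of two labelled graphs; relabel all vertices with label $i$ by label $j$; join every vertex labelled $i$ to every vertex labelled $j$ by an edge ($i\neq j$). *)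

(* Defs.v *)
From Stdlib Require List.
From mathcomp Require Import all_boot.

Set Implicit Arguments.
Unset Strict Implicit.
Unset Printing Implicit Defensive.

Record sgraph := SGraph {
  vertex :> finType;
  adj : rel vertex;
  adj_sym : symmetric adj;
  adj_irrefl : irreflexive adj }.

Definition graph_iso (G H : sgraph) : Prop :=
  exists2 f : G -> H, bijective f & forall x y : G, adj (f x) (f y) = adj x y.

Section Induced.
Variables (G : sgraph) (A : {set G}).

Definition induced_adj : rel {x : G | x \in A} :=
  fun x y => adj (val x) (val y).

Lemma induced_adj_sym : symmetric induced_adj.
Proof. by move=> x y; apply: adj_sym. Qed.

Lemma induced_adj_irrefl : irreflexive induced_adj.
Proof. by move=> x; apply: adj_irrefl. Qed.

Definition induced : sgraph := SGraph induced_adj_sym induced_adj_irrefl.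

End Induced.

Definition contains_induced (G H : sgraph) : Prop :=
  exists A : {set G}, graph_iso (induced A) H.

Definition graph_free (L : seq sgraph) (G : sgraph) : Prop :=
  List.Forall (fun H => ~ contains_induced G H) L.

Section EdgelessGraph.
Variable T : finType.

Definition edgeless_adj : rel T := fun _ _ => false.

Lemma edgeless_adj_sym : symmetric edgeless_adj.
Proof. by []. Qed.

Lemma edgeless_adj_irrefl : irreflexive edgeless_adj.
Proof. by []. Qed.

Definition edgeless : sgraph := SGraph edgeless_adj_sym edgeless_adj_irrefl.

End EdgelessGraph.

Definition four_K1 : sgraph := edgeless 'I_4.

Definition claw_adj : rel 'I_4 := fun i j => (i == ord0) != (j == ord0).

Lemma claw_adj_sym : symmetric claw_adj.
Proof. by move=> i j; rewrite /claw_adj eq_sym. Qed.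

Lemma claw_adj_irrefl : irreflexive claw_adj.
Proof. by move=> i; rewrite /claw_adj eqxx. Qed.

Definition claw : sgraph := SGraph claw_adj_sym claw_adj_irrefl.

Definition C7_adj : rel 'I_7 :=
  fun i j => (j == i.+1 %% 7 :> nat) || (i == j.+1 %% 7 :> nat).

Lemma C7_adj_sym : symmetric C7_adj.
Proof. by move=> i j; rewrite /C7_adj orbC. Qed.

Lemma C7_adj_irrefl : irreflexive C7_adj.
Proof. by case; do 7?[case=> //]. Qed.

Definition C7 : sgraph := SGraph C7_adj_sym C7_adj_irrefl.

(* u, v, a, b, c, d are numbered 0, ..., 5 in this order. *)
Definition bridge_uvab (i : 'I_6) : bool := i < 4.
Definition bridge_uvcd (i : 'I_6) : bool := (i < 2) || (4 <= i).

Definition bridge_adj : rel 'I_6 :=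
  fun i j => (i != j) &&
    ((bridge_uvab i && bridge_uvab j) || (bridge_uvcd i && bridge_uvcd j)).

Lemma bridge_adj_sym : symmetric bridge_adj.
Proof.
move=> i j; rewrite /bridge_adj eq_sym.
by rewrite (andbC (bridge_uvab i)) (andbC (bridge_uvcd i)).
Qed.

Lemma bridge_adj_irrefl : irreflexive bridge_adj.
Proof. by move=> i; rewrite /bridge_adj eqxx. Qed.

Definition bridge : sgraph := SGraph bridge_adj_sym bridge_adj_irrefl.

Section DisjointUnion.
Variables G H : sgraph.

Definition dunion_adj : rel (G + H)%type := fun x y =>
  match x, y with
  | inl a, inl b => adj a b
  | inr a, inr b => adj a b
  | _, _ => false
  end.

Lemma dunion_adj_sym : symmetric dunion_adj.
Proof. by move=> [x|x] [y|y] //=; apply: adj_sym. Qed.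

Lemma dunion_adj_irrefl : irreflexive dunion_adj.
Proof. by move=> [x|x] /=; apply: adj_irrefl. Qed.

Definition dunion : sgraph := SGraph dunion_adj_sym dunion_adj_irrefl.

End DisjointUnion.

Section Join.
Variables (k : nat) (G : sgraph) (lab : G -> 'I_k).
Variables (i j : 'I_k) (neq_ij : i != j).

Definition join_adj : rel G := fun x y =>
  [|| adj x y, (lab x == i) && (lab y == j) | (lab x == j) && (lab y == i)].

Lemma join_adj_sym : symmetric join_adj.
Proof.
move=> x y; rewrite /join_adj adj_sym; congr (_ || _).
by rewrite orbC; congr (_ || _); rewrite andbC.
Qed.

Lemma join_adj_irrefl : irreflexive join_adj.
Proof.
move=> x; rewrite /join_adj adj_irrefl /=.
by case: eqP => [->|]; rewrite ?(negbTE neq_ij) ?andbF.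
Qed.

Definition join : sgraph := SGraph join_adj_sym join_adj_irrefl.

End Join.

Record lgraph (k : nat) := LGraph {
  underlying : sgraph;
  label : underlying -> 'I_k }.

Inductive cw_expr (k : nat) : Type :=
| CwVertex (i : 'I_k)
| CwUnion (t1 t2 : cw_expr k)
| CwRelabel (i j : 'I_k) (t : cw_expr k)
| CwJoin (i j : 'I_k) (neq_ij : i != j) (t : cw_expr k).

Fixpoint cw_eval (k : nat) (t : cw_expr k) : lgraph k :=
  match t with
  | CwVertex i => @LGraph k (edgeless unit) (fun _ => i)
  | CwUnion t1 t2 =>
      let g1 := cw_eval t1 in
      let g2 := cw_eval t2 in
      @LGraph k (dunion (underlying g1) (underlying g2))
        (fun x => match x with inl a => label a | inr b => label b end)
  | CwRelabel i j t =>
      let g := cw_eval t in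
      @LGraph k (underlying g)
        (fun x => if label x == i then j else label x)
  | CwJoin i j neq_ij t =>
      let g := cw_eval t in
      @LGraph k (join (@label k g) neq_ij) (@label k g)
  end.

Definition cw_constructible (k : nat) (G : sgraph) : Prop :=
  exists t : cw_expr k, graph_iso (underlying (cw_eval t)) G.

(* A relation rather than a function: the graph with no vertices is the value
   of no expression, so it has no clique-width. *)
Definition is_clique_width (G : sgraph) (w : nat) : Prop :=
  cw_constructible w G /\
  (forall w' : nat, cw_constructible w' G -> w <= w').

(* Main.v *)
From Stdlib Require Import Classical.
Require Import Defs.
From mathcomp Require Import all_boot.

Set Implicit Arguments.
Unset Strict Implicit.
Unset Printing Implicit Defensive.

(** Fix an induced seven-cycle.  A vertex off the cycle is described by its
    trace, the set of its neighbours on the cycle, and the vertices with a given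
    trace form a clique: otherwise two of them and two consecutive cycle
    vertices make a claw.  The argument sets aside the cycle and all classes
    with at most three vertices, which is a bounded set [D] of vertices, and
    shows that the other, large classes are joined to each other in a very
    regular way ([deviates_unique]).

    The three forbidden graphs leave fourteen traces for a large class: three
    or four consecutive cycle vertices.  For most pairs of such traces a claw or
    a stable set of size four decides whether their vertices are adjacent.  For
    the other pairs the bridge makes any two neighbours of a vertex in the
    opposite class dominate the class of that vertex
    ([shared_private_dominating]), from which it follows that the edges between
    the classes form a matching, or the non-edges do ([dominating_dense]).
    Hence each pair of large classes has a default, joined or not, from which
    every vertex deviates at most once.  Moreover no vertex deviates towards two
    different classes: either two of the three classes involved cannot both be
    large, because of a bridge whose two central vertices are adjacent vertices
    of the cycle ([exclusive_not_large]), or a neighbour in each of the two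
    classes and a suitable cycle vertex make a claw.  That these cases are
    exhaustive is a finite check on traces ([shape_pair], [shape_triple]).  So
    the deviations form a matching on the whole graph, and apart from it the
    adjacencies of a vertex outside [D] depend only on its neighbours in [D].

    Such a graph has bounded clique-width ([cw_constructible_twins]): it is
    built one vertex at a time, matched vertices one right after the other.  At
    each moment the vertices already built have boundedly many different
    neighbourhoods among those still to come, and one label for each of these
    neighbourhoods, plus one for the new vertex, is enough ([built_add]). *)

(** * Building a graph one vertex at a time *)

Section Expressions.
Variables (V : finType) (k : nat).
Implicit Types (P Q : {set V}) (e : rel V) (lab : V -> 'I_k).

(** The relation [e] is arbitrary, and not the adjacency of a fixed graph,
    because the graphs met between two joins are not induced subgraphs of the
    graph that is being built. *)
Definition denotes P e lab :=
  exists (t : cw_expr k) (g : underlying (cw_eval t) -> V),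
    [/\ injective g, forall x, x \in P <-> exists a, g a = x,
        forall a b, adj a b = e (g a) (g b) & forall a, label a = lab (g a)].

Lemma eq_denotes P e e' lab lab' :
  {in P &, e =2 e'} -> {in P, lab =1 lab'} ->
  denotes P e lab -> denotes P e' lab'.
Proof.
move=> ee ll [t [g [gI gP ga gl]]]; exists t, g.
have inP a : g a \in P by apply/gP; exists a.
split=> // [a b|a]; first by rewrite ga ee.
by rewrite gl ll.
Qed.

Lemma denotes_vertex v e lab : ~~ e v v -> denotes [set v] e lab.
Proof.
move=> /negbTE evv; exists (CwVertex (lab v)), (fun=> v); split=> //=.
- by move=> [] [].
- by move=> x; rewrite inE; split=> [/eqP->|[_ ->]//]; exists tt.
Qed.

Lemma denotes_union P Q e lab :
  [disjoint P & Q] -> {in P & Q, forall x y, ~~ e x y && ~~ e y x} ->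
  denotes P e lab -> denotes Q e lab -> denotes (P :|: Q) e lab.
Proof.
move=> dPQ ePQ [t [g [gI gP ga gl]]] [u [h [hI hQ ha hl]]].
have inP a : g a \in P by apply/gP; exists a.
have inQ a : h a \in Q by apply/hQ; exists a.
have ngh a b : g a <> h b.
  by move=> gh; have:= disjointFr dPQ (inP a); rewrite gh inQ.
exists (CwUnion t u), (fun x => match x with inl a => g a | inr b => h b end).
split=> /=.
- by move=> [a|a] [b|b] // => [/gI->|/ngh|/esym/ngh|/hI->].
- move=> x; rewrite inE; split=> [/orP[/gP[a <-]|/hQ[a <-]]|[[a|a] <-]].
  + by exists (inl a).
  + by exists (inr a).
  + by rewrite inP.
  + by rewrite inQ orbT.
- move=> [a|a] [b|b] //=.
  + by have /andP[/negbTE-> _] := ePQ _ _ (inP a) (inQ b).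
  + by have /andP[_ /negbTE->] := ePQ _ _ (inP b) (inQ a).
- by case.
Qed.

Lemma denotes_join P e lab i j : i != j -> denotes P e lab ->
  denotes P (fun x y => [|| e x y, (lab x == i) && (lab y == j)
                          | (lab x == j) && (lab y == i)]) lab.
Proof.
move=> ij [t [g [gI gP ga gl]]]; exists (CwJoin ij t), g; split=> //= a b.
by rewrite /join_adj ga !gl.
Qed.

Lemma denotes_relabel P e lab i j : denotes P e lab ->
  denotes P e (fun x => if lab x == i then j else lab x).
Proof.
move=> [t [g [gI gP ga gl]]]; exists (CwRelabel i j t), g.
by split=> //= a; rewrite gl.
Qed.

(** Joining the label of a fresh isolated vertex to the labels in [js] one after
    the other adds exactly the edges from that vertex to their classes. *)
Lemma denotes_join_vertex P e lab v (js : seq 'I_k) :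
  v \notin P -> {in P, forall x, lab x != lab v} -> lab v \notin js ->
  ~~ e v v -> {in P, forall x, ~~ e x v && ~~ e v x} -> denotes P e lab ->
  denotes (v |: P) (fun x y => [|| e x y, (x == v) && (lab y \in js)
                                  | (y == v) && (lab x \in js)]) lab.
Proof.
move=> vP fresh; elim: js => [|j js IH] => [_ evv isov dP|].
  have dPv : denotes (v |: P) e lab.
    apply: denotes_union (denotes_vertex _ evv) dP.
    - by rewrite disjoints1.
    - by move=> x y; rewrite inE => /eqP->{x} /isov; rewrite andbC.
  by apply: eq_denotes dPv => // x y _ _; rewrite /= !in_nil !andbF !orbF.
rewrite inE negb_or eq_sym => /andP[jl ljs] evv isov dP.
have {IH} := denotes_join jl (IH ljs evv isov dP).
have labv x : x \in v |: P -> (lab x == lab v) = (x == v).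
  by rewrite !inE; case: eqVneq => [-> _|_ /= /fresh/negbTE]; rewrite ?eqxx.
apply: eq_denotes => // x y xP yP; rewrite /= !labv // !inE.
by case: (x == v); case: (y == v); case: (lab x == j); case: (lab y == j);
   case: (e x y); case: (_ \in _); case: (_ \in _).
Qed.

End Expressions.

Section Incremental.
Variable G : sgraph.
Implicit Types P : {set G}.

Definition nbhd (v : G) : {set G} := [set y | adj v y].

(** The classes of this partition of [P] are the sets of vertices that later
    joins need not tell apart. *)
Definition traces P : {set {set G}} := [set nbhd x :\: P | x in P].

(** A label need only remember what a vertex still has to be joined to. *)
Definition built k P :=
  exists lab : G -> 'I_k, denotes P (@adj G) lab /\
    {in P &, forall x y, lab x = lab y -> nbhd x :\: P = nbhd y :\: P}.

(** If every label is in use, two labelled classes have the same trace, by the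
    pigeonhole principle, and can be merged. *)
Lemma built_free_label k P : #|traces P| <= k -> built k.+1 P ->
  exists (lab : G -> 'I_k.+1) l,
    [/\ denotes P (@adj G) lab, {in P, forall x, lab x != l} &
        {in P &, forall x y, lab x = lab y -> nbhd x :\: P = nbhd y :\: P}].
Proof.
move=> leq_k [lab [dP labP]].
case: (boolP [exists l, [forall x in P, lab x != l]]) => [|noFree].
  by case/existsP=> l /forall_inP fl; exists lab, l.
have rep l : {x | (x \in P) && (lab x == l)}.
  apply: sigW; move/existsPn: noFree => /(_ l); rewrite negb_forall_in.
  by case/exists_inP=> x xP; rewrite negbK => xl; exists x; rewrite xP.
pose tr l := nbhd (sval (rep l)) :\: P.
have repE l x : x \in P -> lab x = l -> tr l = nbhd x :\: P.
  rewrite /tr; case: (rep l) => y /= /andP[yP /eqP yl] xP xl.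
  by apply: labP; rewrite // yl xl.
have trT l : tr l \in traces P.
  by rewrite /tr; case: (rep l) => y /= /andP[yP _]; apply: imset_f.
have /injectivePn[i [j ij trij]] : ~~ injectiveb tr.
  apply/injectiveP => /card_imset; move/(_ predT) => eq_k.
  have : #|tr @: predT| <= #|traces P|.
    by apply/subset_leq_card/subsetP=> _ /imsetP[l _ ->].
  by rewrite eq_k cardT size_enum_ord => /leq_trans/(_ leq_k); rewrite ltnn.
exists (fun x => if lab x == i then j else lab x), i; split.
- exact: denotes_relabel.
- by move=> x _ /=; case: (eqVneq (lab x) i) => // _; rewrite eq_sym.
- move=> x y xP yP /= /esym.
  case: (eqVneq (lab x) i) => xi; case: (eqVneq (lab y) i) => yi; last first.
  + by move/esym; apply: labP.
  + by move=> jx; rewrite -(repE j x) // -(repE i y) // trij.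
  + by move=> yj; rewrite -(repE i x) // -(repE j y) // trij.
  + by move=> _; apply: labP => //; rewrite xi yi.
Qed.

Lemma built_vertex k v : built k.+1 [set v].
Proof.
exists (fun=> ord0); split; first by apply: denotes_vertex; rewrite adj_irrefl.
by move=> x y; rewrite !inE => /eqP-> /eqP->.
Qed.

(** As labels determine the adjacencies to [v], the neighbours of [v] in [P] are
    a union of label classes, so joins can create the edges at [v]. *)
Lemma built_add k P v : v \notin P -> #|traces P| <= k ->
  built k.+1 P -> built k.+1 (v |: P).
Proof.
move=> vP leq_k /(built_free_label leq_k)[lab [l [dP fl labP]]].
pose lab' x := if x == v then l else lab x.
have lab'v : lab' v = l by rewrite /lab' eqxx.
have lab'P x : x \in P -> lab' x = lab x.
  by rewrite /lab'; case: eqP => // -> xP; rewrite xP in vP.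
have fl' : {in P, forall x, lab' x != lab' v}.
  by move=> x xP; rewrite lab'v lab'P ?fl.
pose e x y := [&& x != v, y != v & adj x y].
pose js := [seq lab x | x in [set x in P | adj v x]].
have jsP x : x \in P -> (lab x \in js) = adj v x.
  move=> xP; apply/mapP/idP => [[y]|vx]; last first.
    by exists x => //; rewrite mem_enum inE xP.
  rewrite mem_enum inE => /andP[yP vy] lxy.
  have /setP/(_ v) := labP _ _ xP yP lxy.
  by rewrite !inE vP /= ![adj _ v]adj_sym vy.
have ljs : lab' v \notin js.
  rewrite lab'v; apply/mapP=> -[x]; rewrite mem_enum inE => /andP[xP _] lx.
  by have:= fl _ xP; rewrite lx eqxx.
have dPe : denotes P e lab'.
  apply: eq_denotes dP => [x y xP yP|x xP]; last by rewrite lab'P.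
  by rewrite /e; case: eqP xP vP => [->->//|_ _]; case: eqP yP => [->->//|_ _].
exists lab'; split; last first.
  move=> x y; rewrite !inE.
  case: (eqVneq x v) => [->|_] /=; case: (eqVneq y v) => [->|_] //=.
  (* The label of [v] is fresh, so it is shared only by [v] itself. *)
  - by move=> _ yP vy; have:= fl' _ yP; rewrite vy eqxx.
  - by move=> xP _ xv; have:= fl' _ xP; rewrite xv eqxx.
  - move=> xP yP; rewrite !lab'P // => lxy.
    by rewrite setUC -!setDDl (labP _ _ xP yP lxy).
have evv : ~~ e v v by rewrite /e eqxx.
have isov : {in P, forall x, ~~ e x v && ~~ e v x}.
  by move=> x _; rewrite /e eqxx andbF.
apply: eq_denotes (denotes_join_vertex vP fl' ljs evv isov dPe) => // x y.
rewrite !inE /e.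
case: (eqVneq x v) => [->|_]; case: (eqVneq y v) => [->|_] //=.
- by rewrite lab'v (negbTE (_ : l \notin js)) ?adj_irrefl // -lab'v.
- by move=> _ yP; rewrite lab'P // jsP // orbF.
- by move=> xP _; rewrite lab'P // jsP // adj_sym.
- by move=> _ _; rewrite !orbF.
Qed.

Lemma built_setT k : built k setT -> cw_constructible k G.
Proof.
case=> lab [[t [g [gI gP ga gl]]] _]; exists t, g => //.
have gS x : exists a, g a == x by have [[//|a <-] _] := gP x; exists a.
exists (fun x => xchoose (gS x)) => x.
  by apply: gI; apply/eqP; exact: xchooseP (gS (g x)).
exact/eqP/(xchooseP (gS x)).
Qed.

End Incremental.

(** * Twins up to a matching *)

Lemma card_imset_factor (T U W : finType) (g : T -> U) (h : T -> W)
    (A : {set T}) :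
  {in A &, forall x y, h x = h y -> g x = g y} -> #|g @: A| <= #|h @: A|.
Proof.
move=> gh; case: (set_0Vmem A) => [->|[x0 x0A]]; first by
  rewrite !imset0 !cards0.
pose s w := odflt x0 [pick x in A | h x == w].
apply: leq_trans (leq_imset_card (g \o s) (h @: A)).
apply/subset_leq_card/subsetP => _ /imsetP[x xA ->].
apply/imsetP; exists (h x); first exact: imset_f.
rewrite /s /=; case: pickP => [y /andP[yA /eqP hy]|/(_ x)]; last first.
  by rewrite xA eqxx.
by apply: gh.
Qed.

Section Twins.
Variables (G : sgraph) (D : {set G}) (dev : rel G).
Hypothesis dev_sym : symmetric dev.
Hypothesis dev_uniq : forall x y z, dev x y -> dev x z -> y = z.
Hypothesis twins : {in ~: D & &, forall x x' y,
  nbhd x :&: D = nbhd x' :&: D -> y != x -> y != x' ->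
  ~~ dev x y -> ~~ dev x' y -> adj x y = adj x' y}.

Definition dev_closed (P : {set G}) :=
  forall x y, x \in P -> dev x y -> y \in P.

(** The three summands count the traces of the vertices of [D], of the others,
    which are known from their neighbours in [D], and of [v], the one vertex
    whose deviation may still be to come. *)
Lemma traces_bound (P : {set G}) v : dev_closed (P :\ v) ->
  #|traces P| <= (#|D| + 2 ^ #|D|).+1.
Proof.
move=> clP; pose tr x := nbhd x :\: P; set A := P :\ v :\: D.
have sub : traces P \subset tr v |: (tr @: D :|: tr @: A).
  apply/subsetP => _ /imsetP[x xP ->]; rewrite !inE.
  case: (eqVneq x v) => [->|xv]; first by rewrite eqxx.
  case: (boolP (x \in D)) => xD; first by rewrite (imset_f tr xD) orbT.
  by rewrite (imset_f tr (_ : x \in A)) ?orbT // !inE xD xv.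
apply: leq_trans (subset_leq_card sub) _.
apply: leq_trans (leq_card_setU _ _) _; rewrite cards1 add1n ltnS.
apply: leq_trans (leq_card_setU _ _) _; apply: leq_add.
  exact: leq_imset_card.
rewrite -card_powerset.
apply: leq_trans (_ : #|(fun x => nbhd x :&: D) @: A| <= _); last first.
  apply/subset_leq_card/subsetP => _ /imsetP[x _ ->].
  by rewrite powersetE subsetIr.
apply: card_imset_factor => x x' xA x'A eqD; apply/setP=> y.
rewrite !inE; case: (boolP (y \in P)) => //= yP.
case: (boolP (y \in D)) => yD.
  by have /setP/(_ y) := eqD; rewrite !inE yD !andbT.
have far z : z \in A -> [/\ z \in ~: D, y != z & ~~ dev z y].
  move=> /setDP[zPv zD]; split; first by rewrite inE.
  - by apply: contraNneq yP => ->; move: zPv; rewrite !inE => /andP[].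
  - by apply: contra yP => /(clP _ _ zPv); rewrite !inE => /andP[].
have [xD yx dxy] := far _ xA; have [x'D yx' dxy'] := far _ x'A.
have y'D : y \in ~: D by rewrite inE.
exact: twins xD x'D y'D eqD yx yx' dxy dxy'.
Qed.

(** The vertices of each deviating pair are added one right after the other,
    so that at any moment at most one built vertex has a deviation that is still
    to come. *)
Lemma cw_constructible_twins :
  0 < #|G| -> cw_constructible (#|D| + 2 ^ #|D|).+2 G.
Proof.
case/card_gt0P => v0 _; apply: built_setT; set k := (_ + _).+2.
have pair P v : dev_closed P -> v \notin P -> built k (v |: P) ->
    exists Q, [/\ dev_closed Q, built k Q & v |: P \subset Q].
  move=> clP vP bP; case: (pickP (dev v)) => [w vw|noDev].
    exists (w |: (v |: P)); split; last exact: subsetUr.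
    - move=> x y; rewrite !inE => /or3P[/eqP->|/eqP->|xP].
      + by rewrite dev_sym in vw; move/(dev_uniq vw)<-; rewrite eqxx orbT.
      + by move/(dev_uniq vw)<-; rewrite eqxx.
      + by move/(clP _ _ xP)->; rewrite !orbT.
    - case: (boolP (w \in v |: P)) => wP.
        by rewrite (setUidPr _) ?sub1set.
      by apply: built_add bP => //; apply: (@traces_bound _ v); rewrite setU1K.
  exists (v |: P); split=> // x y; rewrite !inE => /predU1P[->|xP].
    by rewrite noDev.
  by move/(clP _ _ xP)->; rewrite orbT.
have grow n P : #|~: P| <= n -> dev_closed P -> built k P -> built k [set: G].
  elim: n P => [|n IH] P leP clP bP; case: (set_0Vmem (~: P)) => [P0|[v vP]].
  - by rewrite -(setCK P) P0 setC0 in bP.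
  - by move: leP; rewrite leqn0 cards_eq0 => /eqP P0; rewrite P0 inE in vP.
  - by rewrite -(setCK P) P0 setC0 in bP.
  - have nvP : v \notin P by rewrite inE in vP.
    have [|Q [clQ bQ sQ]] := pair _ _ clP nvP.
      apply: built_add bP => //; apply: (@traces_bound _ v).
      by rewrite (setDidPl _) // disjoint_sym disjoints1.
    apply: (IH Q) => //; rewrite -ltnS; apply: leq_trans leP.
    apply/proper_card/properP; split.
      by rewrite setCS (subset_trans (subsetUr _ _) sQ).
    by exists v; rewrite // inE negbK (subsetP sQ) ?setU11.
have [|||Q [clQ bQ _]] := @pair set0 v0.
- by move=> x y; rewrite inE.
- by rewrite inE.
- by rewrite setU0; apply: built_vertex.
exact: grow (leqnn _) clQ bQ.
Qed.

End Twins.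

(** * Sparse and dense pairs of sets *)

Section Bipartite.
Variable T : finType.
Implicit Types (r : rel T) (X Y : {set T}).

Definition sparse r X Y :=
  [forall x in X, forall y in Y, forall y' in Y,
     r x y ==> r x y' ==> (y == y')].

Definition dense r := sparse (fun x y => ~~ r x y).

(** The form in which the absence of a bridge restricts the edges between two
    cliques [X] and [Y]. *)
Definition dominating r X Y :=
  forall x x' y y', x \in X -> x' \in X -> y \in Y -> y' \in Y -> y != y' ->
    r x y -> r x y' -> r x' y || r x' y'.

Lemma sparseP r X Y :
  reflect (forall x y y', x \in X -> y \in Y -> y' \in Y ->
             r x y -> r x y' -> y = y') (sparse r X Y).
Proof.
apply: (iffP forall_inP) => [sp x y y' xX yY y'Y xy xy'|sp x xX].
  move/forall_inP: (sp x xX) => /(_ y yY)/forall_inP/(_ y' y'Y).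
  by rewrite xy xy' => /eqP.
apply/forall_inP=> y yY; apply/forall_inP=> y' y'Y.
by apply/implyP=> xy; apply/implyP=> xy'; apply/eqP; apply: (sp x).
Qed.

Lemma sparsePn r X Y : ~~ sparse r X Y ->
  exists x y y', [/\ x \in X, y \in Y, y' \in Y, y != y' & r x y && r x y'].
Proof.
case/forall_inPn=> x xX /forall_inPn[y yY /forall_inPn[y' y'Y]].
rewrite !negb_imply => /and3P[xy xy' yy'].
by exists x, y, y'; rewrite xy xy'.
Qed.

Lemma exists_notin (A : {set T}) (s : seq T) :
  size s < #|A| -> exists2 y, y \in A & y \notin s.
Proof.
move=> ltsA; suff /subsetPn[y] : ~~ (A \subset s) by exists y.
apply: contraL ltsA => /subset_leq_card leAs.
by rewrite -leqNgt (leq_trans leAs) ?card_size.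
Qed.

Section Dichotomy.
Variables (r : rel T) (X Y : {set T}).
Hypothesis domXY : dominating r X Y.
Hypothesis domYX : dominating (fun y x => r x y) Y X.

(** Another vertex [x'] of [X] sees [y1] or [y2], so [x] and [x'] have a common
    neighbour and together dominate [Y]. Hence [x'] sees [y3] and [y4], and
    these two must then dominate [x], which sees neither. *)
Lemma few_nonneighbours x y1 y2 y3 y4 :
  1 < #|X| -> x \in X -> y1 \in Y -> y2 \in Y -> y3 \in Y -> y4 \in Y ->
  y1 != y2 -> r x y1 -> r x y2 -> ~~ r x y3 -> ~~ r x y4 -> y3 = y4.
Proof.
move=> X2 xX y1Y y2Y y3Y y4Y y12 xy1 xy2 xy3 xy4.
apply/eqP; apply: contraT => y34.
have [x' x'X] := @exists_notin X [:: x] X2; rewrite inE => x'x.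
have all_y y : y \in Y -> ~~ r x y -> r x' y.
  move=> yY nxy; have [x'y|x'y] := orP (domXY xX x'X y1Y y2Y y12 xy1 xy2).
  - have := domYX y1Y yY xX x'X _ xy1 x'y.
    by rewrite eq_sym x'x (negbTE nxy) => /(_ isT).
  - have := domYX y2Y yY xX x'X _ xy2 x'y.
    by rewrite eq_sym x'x (negbTE nxy) => /(_ isT).
have := domXY x'X xX y3Y y4Y y34 (all_y _ y3Y xy3) (all_y _ y4Y xy4).
by rewrite (negbTE xy3) (negbTE xy4).
Qed.

(** If [x] has two neighbours, it misses at most one vertex of [Y]; domination
    by pairs of its many neighbours leaves every other vertex of [X] at least two
    neighbours, so that it too misses at most one. *)
Lemma dominating_dense :
  1 < #|X| -> 3 < #|Y| -> ~~ sparse r X Y -> dense r X Y.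
Proof.
move=> X2 Y4 /sparsePn[x [y1 [y2 [xX y1Y y2Y y12 /andP[xy1 xy2]]]]].
apply/sparseP => x' a b x'X aY bY x'a x'b.
suff [u [v [uY vY uv x'u x'v]]] :
    exists u v, [/\ u \in Y, v \in Y, u != v, r x' u & r x' v].
  exact: (few_nonneighbours X2 x'X uY vY).
have more y y' : y \in Y -> y' \in Y -> y != y' -> r x y -> r x y' ->
    r x' y -> exists u v, [/\ u \in Y, v \in Y, u != v, r x' u & r x' v].
  move=> yY y'Y yy' xy xy' x'y.
  (* Since [x] sees all but one of four vertices, it sees [y3] or [y4]. *)
  have [y3 y3Y] := exists_notin (ltnW Y4 : size [:: y; y'] < #|Y|).
  rewrite !inE negb_or => /andP[y3y y3y'].
  have [y4 y4Y] := exists_notin (Y4 : size [:: y; y'; y3] < #|Y|).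
  rewrite !inE !negb_or => /and3P[y4y y4y' y43].
  have aim z : z \in Y -> z != y -> z != y' -> r x z ->
      exists u v, [/\ u \in Y, v \in Y, u != v, r x' u & r x' v].
    move=> zY zy zy' xz.
    rewrite eq_sym in zy'.
    have [x'y'|x'z] := orP (domXY xX x'X y'Y zY zy' xy' xz).
    - by exists y, y'.
    - by exists z, y.
  case: (boolP (r x y3)) => [xy3|nxy3]; first exact: (aim y3).
  case: (boolP (r x y4)) => [xy4|nxy4]; first exact: (aim y4).
  have := few_nonneighbours X2 xX yY y'Y y3Y y4Y yy' xy xy' nxy3 nxy4.
  by move=> y34; rewrite y34 eqxx in y43.
case/orP: (domXY xX x'X y1Y y2Y y12 xy1 xy2) => [x'y1|x'y2].
- exact: (more y1 y2).
- by apply: (more y2 y1) => //; rewrite eq_sym.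
Qed.

End Dichotomy.

(** Two vertices of [Y] miss at most two of the three vertices of [X], so they
    have a common neighbour. *)
Lemma dense_not_sparse r X Y : symmetric r -> 2 < #|X| -> 1 < #|Y| ->
  dense r Y X -> ~~ sparse r X Y.
Proof.
move=> rsym X3 Y2 /sparseP dYX; apply/negP=> /sparseP sXY.
have [y1 y1Y _] := @exists_notin Y [::] (ltnW Y2).
have [y2 y2Y] := @exists_notin Y [:: y1] Y2; rewrite inE => y21.
have all_but_one y : y \in Y -> exists n, {in X, forall x, x != n -> r y x}.
  move=> yY; case: (pickP [pred x in X | ~~ r y x]) => [n /andP[nX yn]|all_y].
    exists n => x xX xn; apply: contraNT xn => yx.
    by apply/eqP; apply: (dYX y).
  by exists y => x xX _; have:= all_y x; rewrite /= xX => /negbFE.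
have [n1 adj1] := all_but_one _ y1Y; have [n2 adj2] := all_but_one _ y2Y.
have [x xX] := exists_notin (X3 : size [:: n1; n2] < #|X|).
rewrite !inE negb_or => /andP[xn1 xn2].
have y12 : y2 = y1 by apply: (sXY x) => //; rewrite rsym ?adj1 ?adj2.
by rewrite y12 eqxx in y21.
Qed.

End Bipartite.

(** * Induced copies of the forbidden graphs *)

Section Copies.
Variable G : sgraph.

Lemma contains_inducedP (H : sgraph) : contains_induced G H ->
  exists2 f : H -> G, injective f & forall x y, adj (f x) (f y) = adj x y.
Proof.
case=> A [g [h gK hK] gadj]; exists (val \o h).
  by apply: inj_comp val_inj (can_inj hK).
by move=> x y /=; rewrite -[in RHS](hK x) -[in RHS](hK y) gadj.
Qed.

(** It is enough to compare the two graphs on ordered pairs, which halves the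
    case analyses below and provides injectivity at the same time. *)
Lemma induced_copy n (e : rel 'I_n) es ei (f : 'I_n -> G) :
  (forall i j : 'I_n, i < j -> f i != f j /\ adj (f i) (f j) = e i j) ->
  contains_induced G (@SGraph 'I_n e es ei).
Proof.
move=> fP.
have fI : injective f.
  move=> i j fij; apply: val_inj; case: (ltngtP i j) => // /fP[];
  by rewrite fij eqxx.
have fadj i j : adj (f i) (f j) = e i j.
  case: (ltngtP i j) => [/fP[]//|/fP[_]|/val_inj->].
  - by rewrite adj_sym es.
  - by rewrite adj_irrefl ei.
have pre (x : {x : G | x \in f @: setT}) : {i | f i == val x}.
  by apply: sigW; case/imsetP: (valP x) => i _ ->; exists i.
exists (f @: setT), (fun x => sval (pre x)).
  exists (fun i => exist _ (f i) (imset_f f (in_setT i))) => [x|i].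
    by apply: val_inj => /=; case: (pre x) => i /= /eqP.
  by apply: fI; case: (pre _) => j /= /eqP.
move=> x y /=; case: (pre x) => i /= /eqP fx; case: (pre y) => j /= /eqP fy.
by rewrite -fadj fx fy.
Qed.

Hypothesis no_claw : ~ contains_induced G claw.
Hypothesis no_4K1 : ~ contains_induced G four_K1.
Hypothesis no_bridge : ~ contains_induced G bridge.

Lemma claw_free (c x y z : G) : adj c x -> adj c y -> adj c z ->
  x != y -> x != z -> y != z -> [|| adj x y, adj x z | adj y z].
Proof.
move=> cx cy cz xy xz yz; apply: contraT; rewrite !negb_or.
case/and3P=> /negbTE nxy /negbTE nxz /negbTE nyz; case: no_claw.
apply: (@induced_copy _ _ _ _ (tnth [tuple c; x; y; z])).
have neq (u v : G) : adj u v -> u != v.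
  by apply: contraTneq => ->; rewrite adj_irrefl.
by case=> [[|[|[|[|i]]]] //= Hi]; case=> [[|[|[|[|j]]]] //= Hj] _;
   rewrite !(tnth_nth c) /= ?neq.
Qed.

Lemma stable_lt4 (x1 x2 x3 x4 : G) : uniq [:: x1; x2; x3; x4] ->
  [|| adj x1 x2, adj x1 x3, adj x1 x4, adj x2 x3, adj x2 x4 | adj x3 x4].
Proof.
move=> Ux; apply: contraT; rewrite !negb_or.
move=> /and5P[/negbTE n12 /negbTE n13 /negbTE n14 /negbTE n23].
move=> /andP[/negbTE n24 /negbTE n34]; case: no_4K1.
apply: (@induced_copy _ _ _ _ (tnth [tuple x1; x2; x3; x4])) => i j lt_ij.
split.
  by rewrite !(tnth_nth x1) nth_uniq ?ltn_ord // neq_ltn lt_ij.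
case: i j lt_ij => [[|[|[|[|i]]]] //= Hi]; case=> [[|[|[|[|j]]]] //= Hj] _;
by rewrite !(tnth_nth x1).
Qed.

Lemma bridge_free (u v a b c d : G) :
  all (adj u) [:: v; a; b; c; d] -> all (adj v) [:: a; b; c; d] ->
  adj a b -> adj c d -> [|| adj a c, adj a d, adj b c | adj b d].
Proof.
case/andP=> uv /and5P[ua ub uc ud _] /and5P[va vb vc vd _] ab cd.
apply: contraT; rewrite !negb_or.
case/and4P=> /negbTE nac /negbTE nad /negbTE nbc /negbTE nbd; case: no_bridge.
have neq (x y : G) : adj x y -> x != y.
  by apply: contraTneq => ->; rewrite adj_irrefl.
have ac : a != c by apply: contraTneq ab => ->; rewrite adj_sym nbc.
have ad : a != d by apply: contraTneq ab => ->; rewrite adj_sym nbd.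
have bc : b != c by apply: contraTneq ab => ->; rewrite nac.
have bd : b != d by apply: contraTneq ab => ->; rewrite nad.
apply: (@induced_copy _ _ _ _ (tnth [tuple u; v; a; b; c; d])).
by case=> [[|[|[|[|[|[|i]]]]]] //= Hi]; case=> [[|[|[|[|[|[|j]]]]]] //= Hj] _;
   rewrite !(tnth_nth u) /= ?neq.
Qed.

End Copies.

(** * Traces on the seven-cycle *)

Definition cyc i j := (j == i.+1 %% 7) || (i == j.+1 %% 7).

(** Traces are sequences of seven booleans and quantifiers range over an explicit
    list of indices, so that statements about all traces can be computed. *)
Definition ex7 (p : pred nat) := has p (iota 0 7).

Lemma ex7P (p : pred nat) : ex7 p -> exists2 i, i < 7 & p i.
Proof. by case/hasP=> i; rewrite mem_iota => lt7 pi; exists i. Qed.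

Definition stable3 (p : pred nat) :=
  ex7 (fun i => ex7 (fun j => ex7 (fun k =>
    [&& p i, p j, p k, uniq [:: i; j; k], ~~ cyc i j, ~~ cyc i k
      & ~~ cyc j k]))).

Definition on (s : seq bool) i := nth false s i.

Definition off s i := ~~ on s i.

(** Each rule below asks for cycle vertices which, together with vertices having
    the given traces, would make a claw, a stable set of size four or a bridge.
    It thereby restricts the traces that occur, the adjacencies between vertices
    with these traces, or the sizes of their classes. *)
Section Rules.
Implicit Types s t u : seq bool.

Definition isolated s :=
  ex7 (fun i => ex7 (fun j => ex7 (fun k =>
    [&& on s i, off s j, off s k, cyc i j, cyc i k, j != k & ~~ cyc j k]))).

Definition two_edges s :=
  ex7 (fun i => ex7 (fun j => ex7 (fun k => ex7 (fun l =>
    [&& on s i, on s j, on s k, on s l, cyc i j, cyc k l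
      & ~~ [|| cyc i k, cyc i l, cyc j k | cyc j l]])))).

Definition realizable s :=
  [&& ~~ stable3 (on s), ~~ stable3 (off s) & ~~ isolated s].

Definition forced_edge s t :=
  ex7 (fun i => ex7 (fun j =>
    [&& on s i, on t i, off s j, off t j & cyc i j])) ||
  ex7 (fun i => ex7 (fun j =>
    [&& off s i, off t i, off s j, off t j & (i != j) && ~~ cyc i j])).

Definition two_private s t :=
  ex7 (fun i => ex7 (fun j =>
    [&& on s i, off t i, on s j, off t j & (i != j) && ~~ cyc i j])).

Definition forced_nonedge s t := two_private s t || two_private t s.

Definition shared_private s t :=
  ex7 (fun i => ex7 (fun j => [&& on s i, on t i, on s j, off t j & cyc i j])).

Definition shared_edge s t :=
  ex7 (fun i => ex7 (fun j => [&& on s i, on t i, on s j, on t j & cyc i j])).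

Definition private_edge s t :=
  ex7 (fun i => ex7 (fun k => ex7 (fun l =>
    [&& on s i, on t i, on t k && off s k, on t l && off s l, cyc k l
      & ~~ cyc i k && ~~ cyc i l]))).

Definition exclusive s t := shared_edge s t && private_edge s t.

Definition free_pair s t := ~~ forced_edge s t && ~~ forced_nonedge s t.

Definition third_claw s t u :=
  forced_nonedge t u && ex7 (fun i => [&& on s i, off t i & off u i]).

Fixpoint bitseqs n : seq (seq bool) :=
  if n is m.+1 then
    [seq true :: s | s <- bitseqs m] ++ [seq false :: s | s <- bitseqs m]
  else [:: [::]].

Lemma mem_bitseqs n s : size s = n -> s \in bitseqs n.
Proof.
elim: n s => [|n IH] [|b s] //= [/IH sP].
by rewrite mem_cat; case: b; rewrite map_f ?orbT.
Qed.

(** The traces that a large class can have. They are the seven sets of three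
    consecutive cycle vertices and the seven sets of four. *)
Definition shapes := [seq s <- bitseqs 7 | realizable s && ~~ two_edges s].

Lemma realizable_forced_edge s :
  size s = 7 -> realizable s -> forced_edge s s.
Proof.
have /allP all_s : all (fun s => realizable s ==> forced_edge s s) (bitseqs 7).
  by vm_compute.
by move=> /mem_bitseqs/all_s/implyP; apply.
Qed.

Lemma shape_pair s t : s \in shapes -> t \in shapes ->
  [|| forced_edge s t, forced_nonedge s t
    | shared_private s t && shared_private t s].
Proof.
have /allP all_s : let l := shapes in all (fun s => all (fun t =>
    [|| forced_edge s t, forced_nonedge s t
      | shared_private s t && shared_private t s]) l) l.
  by vm_compute.
by move=> /all_s/allP; apply.
Qed.

(** Let [s], [t], [u] consist of consecutive vertices. When [s] has length
    four, two of the three classes exclude each other. When [s] has length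
    three, the only other case is that [t] and [u] are its rotations by two
    positions in either direction: then the middle vertex of [s] is in neither. *)
Lemma shape_triple s t u : s \in shapes -> t \in shapes -> u \in shapes ->
  t != u -> free_pair s t -> free_pair s u ->
  [|| exclusive s t, exclusive t s, exclusive s u, exclusive u s,
      exclusive t u, exclusive u t | third_claw s t u].
Proof.
have /allP all_s : let l := shapes in all (fun s =>
    let fs := [seq t <- l | free_pair s t] in all (fun t => all (fun u =>
      (t != u) ==>
      [|| exclusive s t, exclusive t s, exclusive s u, exclusive u s,
          exclusive t u, exclusive u t | third_claw s t u]) fs) fs) l.
  by vm_compute.
move=> /all_s/allP all_t tS uS tu st su.
have /all_t/allP all_u : t \in [seq t <- shapes | free_pair s t].
  by rewrite mem_filter st.
have /all_u/implyP : u \in [seq u <- shapes | free_pair s u].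
  by rewrite mem_filter su.
exact.
Qed.

End Rules.

(** * Classes of vertices with the same trace *)

Section Host.
Variables (G : sgraph) (c : nat -> G).
Hypothesis no_claw : ~ contains_induced G claw.
Hypothesis no_4K1 : ~ contains_induced G four_K1.
Hypothesis no_bridge : ~ contains_induced G bridge.
Hypothesis c_eq : forall i j, i < 7 -> j < 7 -> (c i == c j) = (i == j).
Hypothesis c_adj : forall i j, i < 7 -> j < 7 -> adj (c i) (c j) = cyc i j.

Implicit Types s t u : 7.-tuple bool.

Definition cycle7 : {set G} := [set c i | i : 'I_7].

Definition trace (v : G) : 7.-tuple bool := [tuple adj v (c i) | i < 7].

Definition class (s : 7.-tuple bool) : {set G} :=
  [set v in ~: cycle7 | trace v == s].

Definition large s := 3 < #|class s|.

Lemma on_trace v i : i < 7 -> on (trace v) i = adj v (c i).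
Proof. by move=> i7; rewrite /on -[i]/(val (Ordinal i7)) nth_mktuple. Qed.

Lemma in_class v s : v \in class s ->
  [/\ trace v = s, forall i, i < 7 -> adj v (c i) = on s i
    & forall i, i < 7 -> v != c i].
Proof.
rewrite !inE => /andP[vC /eqP <-]; split=> // i i7; first by rewrite on_trace.
apply: contraNneq vC => ->; apply/imsetP.
by exists (Ordinal i7).
Qed.

(** Three pairwise nonadjacent cycle vertices make a claw with [v] if all are
    neighbours of [v], and a stable set of size four if none is. A neighbour of
    [v] on the cycle whose two cycle neighbours are not neighbours of [v] is the
    centre of a claw. *)
Lemma class_realizable v s : v \in class s -> realizable s.
Proof.
case/in_class => _ vs vC; apply/and3P; split; apply/negP.
- case/ex7P=> i i7 /ex7P[j j7 /ex7P[k k7]].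
  case/and5P=> si sj sk Uijk /and3P[nij nik njk].
  move: Uijk; rewrite /= !inE !negb_or => /and3P[/andP[ij ik] jk _].
  have := @claw_free G no_claw v (c i) (c j) (c k).
  rewrite !vs // !c_eq // !c_adj // => /(_ si sj sk ij ik).
  by rewrite jk (negbTE nij) (negbTE nik) (negbTE njk) => /(_ isT).
- case/ex7P=> i i7 /ex7P[j j7 /ex7P[k k7]].
  case/and5P=> si sj sk Uijk /and3P[nij nik njk].
  have := @stable_lt4 G no_4K1 v (c i) (c j) (c k).
  rewrite !vs // !c_adj // (negbTE si) (negbTE sj) (negbTE sk).
  rewrite (negbTE nij) (negbTE nik) (negbTE njk) .
  rewrite /= !inE !negb_or !vC // !c_eq //.
  by move: Uijk; rewrite /= !inE !negb_or => -> /(_ isT).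
- case/ex7P=> i i7 /ex7P[j j7 /ex7P[k k7]].
  case/and5P=> si sj sk ij /and3P[ik jk njk].
  have := @claw_free G no_claw (c i) v (c j) (c k).
  rewrite adj_sym !vs // !c_eq // !c_adj // !vC //.
  move=> /(_ si ij ik isT isT jk).
  by rewrite (negbTE sj) (negbTE sk) (negbTE njk).
Qed.

(** If [x] and [y] were not adjacent, then with a cycle vertex they would be the
    leaves of a claw centred at a common neighbour on the cycle, or with two
    cycle vertices they would be a stable set. *)
Lemma forced_edgeP x y s t : x \in class s -> y \in class t -> x != y ->
  forced_edge s t -> adj x y.
Proof.
case/in_class=> _ xs xC /in_class[_ yt yC] xy /orP[]/ex7P[i i7 /ex7P[j j7]].
- case/and5P=> si ti sj tj ij.
  have := @claw_free G no_claw (c i) x y (c j).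
  rewrite ![adj (c i) _]adj_sym xs // yt // [adj (c j) _]adj_sym c_adj //.
  move=> /(_ si ti ij xy); rewrite xC // yC // xs // yt //.
  by rewrite (negbTE sj) (negbTE tj) !orbF; apply.
- case/and5P=> si ti sj tj /andP[ij nij].
  have := @stable_lt4 G no_4K1 x y (c i) (c j).
  rewrite !xs // !yt // c_adj // (negbTE si) (negbTE sj) (negbTE ti).
  rewrite (negbTE tj) (negbTE nij) /= !orbF; apply.
  by rewrite !inE !negb_or xy !xC // !yC // c_eq // ij.
Qed.

(** If [x] and [y] were adjacent, [x] would be the centre of a claw. *)
Lemma two_privateP x y s t : x \in class s -> y \in class t ->
  two_private s t -> ~~ adj x y.
Proof.
case/in_class=> _ xs xC /in_class[_ yt yC] /ex7P[i i7 /ex7P[j j7]].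
case/and5P=> si ti sj tj /andP[ij nij]; apply/negP=> xy.
have := @claw_free G no_claw x y (c i) (c j).
rewrite !xs // !yt // c_adj // c_eq // !yC // => /(_ xy si sj isT isT ij).
by rewrite (negbTE ti) (negbTE tj) (negbTE nij).
Qed.

Lemma forced_nonedgeP x y s t : x \in class s -> y \in class t ->
  forced_nonedge s t -> ~~ adj x y.
Proof.
move=> xs yt /orP[st|ts]; first exact: two_privateP st.
by rewrite adj_sym; apply: two_privateP ts.
Qed.

Lemma class_clique x y s : x \in class s -> y \in class s -> x != y -> adj x y.
Proof.
move=> xs ys xy; apply: (forced_edgeP xs ys xy).
by apply: realizable_forced_edge (class_realizable xs); apply: size_tuple.
Qed.

(** Two vertices with the same trace are adjacent, hence they are the central
    edge of a bridge if that trace contains two disjoint edges with no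
    edge between them. *)
Lemma large_shape s : large s -> tval s \in shapes.
Proof.
move=> s4; have [x xs _] := @exists_notin _ _ [::] (ltnW (ltnW (ltnW s4))).
have [y ys] := @exists_notin _ _ [:: x] (ltnW (ltnW s4)).
rewrite inE => yx.
rewrite mem_filter mem_bitseqs ?size_tuple // andbT (class_realizable xs) /=.
apply/negP=> /ex7P[i i7 /ex7P[j j7 /ex7P[k k7 /ex7P[l l7]]]].
case/and5P=> si sj sk sl /and3P[ij kl nijkl].
have xy : adj x y by apply: (class_clique xs ys); rewrite eq_sym.
case/in_class: xs => _ xs _; case/in_class: ys => _ ys _.
have := @bridge_free G no_bridge x y (c i) (c j) (c k) (c l).
rewrite /= !xs // !ys // !c_adj // xy si sj sk sl => /(_ isT isT ij kl).
by rewrite (negbTE nijkl).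
Qed.

(** Let [i] be in both traces and its neighbour [j] only in the first. If [x']
    saw neither [y] nor [y'], the cliques [x, i, y, y'] and [x, i, x', j] would
    form a bridge. *)
Lemma shared_private_dominating s t :
  shared_private s t -> dominating (@adj G) (class s) (class t).
Proof.
case/ex7P=> i i7 /ex7P[j j7 /and5P[si ti sj tj ij]].
move=> x x' y y' xs x's yt y't yy' xy xy'.
have [<-|xx'] := eqVneq x x'; first by rewrite xy.
have axx' := class_clique xs x's xx'; have ayy' := class_clique yt y't yy'.
case/in_class: xs => _ xs _; case/in_class: x's => _ x's _.
case/in_class: yt => _ yt _; case/in_class: y't => _ y't _.
have := @bridge_free G no_bridge x (c i) y y' x' (c j).
rewrite /= ![adj (c i) _]adj_sym [adj (c j) _]adj_sym.
rewrite !xs // !x's // !yt // !y't // c_adj // xy xy' axx' si sj ti.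
move=> /(_ isT)/=; rewrite ij => /(_ isT ayy' isT).
by rewrite (negbTE tj) !orbF /= ![adj _ x']adj_sym.
Qed.

(** The private edge [l m] of the second trace forbids a vertex [x] with two
    neighbours [y], [y'] in the second class: [y, y', x, k] and [y, y', l, m]
    would form a bridge. So two vertices of the first class leave two vertices
    of the second class untouched, and these four vertices form a bridge with
    the shared edge [i j]. *)
Lemma exclusive_not_large s t : exclusive s t -> large s -> ~~ large t.
Proof.
case/andP=> /ex7P[i i7 /ex7P[j j7 /and5P[si ti sj tj ij]]].
case/ex7P=> k k7 /ex7P[l l7 /ex7P[m m7 /and5P[sk tk]]].
case/andP=> tl sl /andP[tm sm] /and3P[lm nkl nkm] s4; apply/negP=> t4.
have one x y y' : x \in class s -> y \in class t -> y' \in class t ->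
    adj x y -> adj x y' -> y = y'.
  move=> xs yt y't xy xy'; apply/eqP; apply: contraT => yy'.
  have ayy' := class_clique yt y't yy'.
  case/in_class: xs => _ xs _.
  case/in_class: yt => _ yt _; case/in_class: y't => _ y't _.
  have := @bridge_free G no_bridge y y' x (c k) (c l) (c m).
  rewrite /= ![adj _ x]adj_sym !yt // !y't // !xs // !c_adj //.
  rewrite xy xy' ayy' sk tk tl tm lm => /(_ isT isT isT isT).
  by rewrite (negbTE sl) (negbTE sm) (negbTE nkl) (negbTE nkm).
have [x xs _] := @exists_notin _ _ [::] (ltnW (ltnW (ltnW s4))).
have [x' x's] := @exists_notin _ _ [:: x] (ltnW (ltnW s4)).
rewrite inE eq_sym => xx'.
have nb z : z \in class s ->
    exists n, {in class t, forall y, y != n -> ~~ adj z y}.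
  move=> zs; case: (pickP [pred y in class t | adj z y]) => [n|no_nbr].
    case/andP=> nt zn; exists n => y yt; apply: contraNN => zy.
    by apply/eqP; apply: (one z).
  by exists z => y yt _; have := no_nbr y; rewrite /= yt => /= ->.
have [n nP] := nb x xs; have [n' n'P] := nb x' x's.
have [y yt] := @exists_notin _ _ [:: n; n'] (ltnW t4).
rewrite !inE negb_or => /andP[yn yn'].
have [y' y't] := @exists_notin _ _ [:: n; n'; y] t4.
rewrite !inE !negb_or => /and3P[y'n y'n' y'y].
have axx' := class_clique xs x's xx'.
have ayy' : adj y y' by apply: (class_clique yt y't); rewrite eq_sym.
have:= @bridge_free G no_bridge (c i) (c j) x x' y y'.
have [n1 n2] := (nP _ yt yn, nP _ y't y'n).
have [n3 n4] := (n'P _ yt yn', n'P _ y't y'n').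
rewrite (negbTE n1) (negbTE n2) (negbTE n3) (negbTE n4).
case/in_class: xs => _ xs _; case/in_class: x's => _ x's _.
case/in_class: yt => _ yt _; case/in_class: y't => _ y't _.
rewrite /= !c_adj // ![adj (c _) x]adj_sym ![adj (c _) x']adj_sym.
rewrite ![adj (c _) y]adj_sym ![adj (c _) y']adj_sym.
rewrite !xs // !x's // !yt // !y't // ij si sj ti tj.
by move=> /(_ isT isT axx' ayy').
Qed.


(** * Deviations between large classes *)

(** The default adjacency between two large classes. *)
Let joined s t := ~~ sparse (@adj G) (class s) (class t).

Lemma large_dense s t : large s -> large t -> joined s t ->
  dense (@adj G) (class s) (class t).
Proof.
move=> s4 t4 spr.
have /or3P[st|st|/andP[st ts]] := shape_pair (large_shape s4) (large_shape t4).
- apply/sparseP => x y y' xs yt y't xy xy'.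
  have eq_x z : z \in class t -> ~~ adj x z -> x = z.
    move=> zt; apply: contraNeq => xz; exact: forced_edgeP xz st.
  by rewrite -(eq_x y) // -(eq_x y').
- case/sparsePn: spr => x [y [_ [xs yt _ _ /andP[xy _]]]].
  by have:= forced_nonedgeP xs yt st; rewrite xy.
apply: dominating_dense spr => //; last exact: ltnW (ltnW s4).
  exact: shared_private_dominating.
move=> y y' x x' yt y't xs x's xx'; rewrite ![adj _ y]adj_sym.
rewrite ![adj _ y']adj_sym; exact: (shared_private_dominating ts).
Qed.

Lemma joined_sym s t : large s -> large t -> joined s t = joined t s.
Proof.
suff imp a b : large a -> large b -> joined a b -> joined b a.
  by move=> s4 t4; apply/idP/idP; apply: imp.
move=> a4 b4 ab; apply: dense_not_sparse (large_dense a4 b4 ab).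
- exact: adj_sym.
- exact: ltnW b4.
- exact: ltnW (ltnW a4).
Qed.

Definition exceptional : {set G} := cycle7 :|: [set v | ~~ large (trace v)].

Lemma card_exceptional : #|exceptional| <= 7 + 2 ^ 7 * 3.
Proof.
have sub : exceptional \subset
    cycle7 :|: \bigcup_(s : 7.-tuple bool | ~~ large s) class s.
  apply/subsetP => v; rewrite !inE; case: (boolP (v \in cycle7)) => //= vC vl.
  by apply/bigcupP; exists (trace v); rewrite // !inE vC /=.
apply: leq_trans (subset_leq_card sub) (leq_trans (leq_card_setU _ _) _).
apply: leq_add.
  by rewrite -[7]card_ord; apply: leq_imset_card.
apply: leq_trans (_ : \sum_(s : 7.-tuple bool | ~~ large s) 3 <= _).
  elim/big_rec2: _ => [|s n A sl leA]; first by rewrite cards0.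
  apply: leq_trans (leq_card_setU _ _) (leq_add _ leA).
  by rewrite leqNgt.
rewrite sum_nat_const leq_mul2r; apply: leq_trans (max_card _) _.
by rewrite card_tuple card_bool.
Qed.

Lemma notin_exceptional v : v \notin exceptional ->
  v \in class (trace v) /\ large (trace v).
Proof. by rewrite !inE negb_or negbK => /andP[-> ->]; rewrite eqxx. Qed.

Definition deviates : rel G := fun x y =>
  [&& x \notin exceptional, y \notin exceptional, x != y
    & adj x y != joined (trace x) (trace y)].

Lemma deviates_sym : symmetric deviates.
Proof.
move=> x y; rewrite /deviates adj_sym [x == y]eq_sym.
case: (boolP (x \in _)) => //= xE; case: (boolP (y \in _)) => //= yE.
have [_ xl] := notin_exceptional xE; have [_ yl] := notin_exceptional yE.
by rewrite joined_sym.
Qed.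

(** A forced pair of classes is complete or has no edge, so nobody deviates. *)
Lemma deviates_free x y : deviates x y -> free_pair (trace x) (trace y).
Proof.
case/and4P=> /notin_exceptional[xc xl] /notin_exceptional[yc yl] xy dev.
rewrite /free_pair; apply/andP; split; apply: contraNN dev => st.
  rewrite (forced_edgeP xc yc xy st) eq_sym eqb_id; apply/negP=> /sparseP sp.
  have [y1 y1c] := exists_notin (ltnW (ltnW yl) : size [:: x] < _).
  rewrite inE => y1x.
  have [y2 y2c] := exists_notin (ltnW yl : size [:: x; y1] < _).
  rewrite !inE negb_or => /andP[y2x y21].
  have y12 : y2 = y1.
    by apply: (sp x); rewrite // (forced_edgeP _ _ _ st) // eq_sym.
  by rewrite y12 eqxx in y21.
rewrite (negbTE (forced_nonedgeP xc yc st)) eq_sym eqbF_neg negbK.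
apply/sparseP => x' z z' x'c zc _ xz.
by have := forced_nonedgeP x'c zc st; rewrite xz.
Qed.

(** Either [y] itself is a neighbour, or [y] is the only non-neighbour in a
    class with other members. *)
Lemma deviates_neighbour x y : deviates x y ->
  exists2 y', y' \in class (trace y) & adj x y'.
Proof.
case/and4P=> /notin_exceptional[xc xl] /notin_exceptional[yc yl] _.
case: (boolP (adj x y)) => [xy _|nxy]; first by exists y.
rewrite eq_sym eqbF_neg negbK => /(large_dense xl yl)/sparseP dn.
have [y' y'c] := exists_notin (ltnW (ltnW yl) : size [:: y] < _).
rewrite inE => y'y; exists y' => //; apply: contraNT y'y => nxy'.
by apply/eqP; apply: (dn x).
Qed.

(** Within one class this is the matching property of sparse and dense pairs.
    Two deviations towards different classes give [x] nonadjacent neighbours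
    [y'] and [z'] in these classes, whence a claw with the cycle vertex
    [c i]. *)
Lemma deviates_unique x y z : deviates x y -> deviates x z -> y = z.
Proof.
move=> dxy dxz.
have [y' y'c xy'] := deviates_neighbour dxy.
have [z' z'c xz'] := deviates_neighbour dxz.
have /and4P[/notin_exceptional[xc xl] /notin_exceptional[yc yl] _ exy] := dxy.
have /and4P[_ /notin_exceptional[zc zl] _ exz] := dxz.
have [eq_t|neq_t] := eqVneq (trace y) (trace z).
  move: exy exz; rewrite eq_t; rewrite eq_t in yc yl.
  case: (boolP (joined _ _)) => [/(large_dense xl yl)|/negbNE] /sparseP few.
    by rewrite !eqb_id => nxy nxz; apply: (few x).
  by rewrite !eqbF_neg !negbK => xy xz; apply: (few x).
have := shape_triple (large_shape xl) (large_shape yl) (large_shape zl) neq_t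
  (deviates_free dxy) (deviates_free dxz).
have excl s t : large s -> large t -> exclusive s t = false.
  by move=> sl tl; apply/negP=> /exclusive_not_large/(_ sl); rewrite tl.
rewrite !excl //= => /andP[yz /ex7P[i i7 /and3P[xi yi zi]]].
have := @claw_free G no_claw x y' z' (c i).
have nyz := forced_nonedgeP y'c z'c yz; have [ty ay ny] := in_class y'c.
have [tz az nz] := in_class z'c; have [_ ax _] := in_class xc.
rewrite ay // az // ax // ny // nz // (negbTE nyz) (negbTE yi) (negbTE zi).
move=> /(_ xy' xz' xi _ isT isT) claw; apply/eqP; apply: contraT => _.
apply: claw; apply: contraNneq neq_t => yz'.
by rewrite -ty -tz yz'.
Qed.

Lemma C7_host_cw : 0 < #|G| ->
  cw_constructible (#|exceptional| + 2 ^ #|exceptional|).+2 G.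
Proof.
apply: (cw_constructible_twins deviates_sym deviates_unique).
move=> x x' y; rewrite ![_ \in ~: _]inE => xE x'E yE eqN yx yx'.
have eqt : trace x = trace x'.
  apply: eq_from_tnth => i; rewrite !tnth_mktuple.
  have /setP/(_ (c i)) := eqN; rewrite !inE.
  by rewrite (imset_f (fun i : 'I_7 => c i)) //= !andbT.
rewrite /deviates xE x'E yE /= ![_ == y]eq_sym yx yx' /= !negbK eqt.
by move/eqP-> => /eqP->.
Qed.

End Host.

(** * The bound on the clique-width *)

(** Constructibility is a proposition with no decision procedure at hand, so the
    least width comes from excluded middle. *)
Lemma cw_constructible_min G w :
  cw_constructible w G -> exists2 w', is_clique_width G w' & w' <= w.
Proof.
elim/ltn_ind: w => w IH wG.
case: (classic (exists2 v, cw_constructible v G & v < w)) => [[v vG vw]|minw].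
  have [w' w'G w'v] := IH v vw vG; exists w' => //.
  exact: leq_trans w'v (ltnW vw).
exists w => //; split=> // v vG; rewrite leqNgt; apply/negP=> vw.
by apply: minw; exists v.
Qed.

Theorem theorem5p10 :
  exists k : nat, forall G : sgraph,
    graph_free [:: claw; four_K1; bridge] G ->
    contains_induced G C7 ->
    exists2 w : nat, is_clique_width G w & w <= k.
Proof.
have [k kP] : exists k, forall d, d <= 7 + 2 ^ 7 * 3 -> (d + 2 ^ d).+2 <= k.
  (* Generalizing the bound keeps the huge numeral [2 ^ 391] from being
     computed. *)
  move: (7 + _) => n; exists (n + 2 ^ n).+2 => d dn.
  by rewrite !ltnS leq_add ?leq_pexp2l.
exists k => G freeG /contains_inducedP[f fI fadj].
have [no_claw [no_4K1 no_bridge]] : ~ contains_induced G claw /\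
    ~ contains_induced G four_K1 /\ ~ contains_induced G bridge.
  by split; last split; apply: (proj1 (List.Forall_forall _ _) freeG);
     rewrite /=; auto.
pose c i := f (inord i).
have c_eq i j : i < 7 -> j < 7 -> (c i == c j) = (i == j).
  by move=> i7 j7; rewrite (inj_eq fI) -val_eqE /= !inordK.
have c_adj i j : i < 7 -> j < 7 -> adj (c i) (c j) = cyc i j.
  by move=> i7 j7; rewrite fadj /= /C7_adj !inordK.
have G0 : 0 < #|G| by apply/card_gt0P; exists (f ord0).
have [w wG wle] := cw_constructible_min
  (C7_host_cw no_claw no_4K1 no_bridge c_eq c_adj G0).
exists w => //; apply: leq_trans wle (kP _ _).
exact: card_exceptional.
Qed.
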